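(* Let $n\ge 1$ be an integer, let $K=\{z_0,z_1,\ldots,z_n\}$ be a set of $n+1$ distinct points in $\mathbb{C}$, and let $w\in\mathbb{C}\setminus K$. Then $w$ is in the $n$-polynomial hull $\mathcal{P}_n(K)$ of $K$ if and only if all the values $$(z_i-w)\prod_{j\ne i}(z_i-z_j),\qquad i=0,1,\ldots,n,$$ lie on the same real half-line (ray) from the origin in $\mathbb{C}$.
   Context: For a compact set $K\subset\mathbb{C}$ and a polynomial $P$ with complex coefficients, $\|P\|_K=\sup_{z\in K}|P(z)|$. For $d\in\mathbb{N}$, the $d$-polynomial hull of $K$ is $\mathcal{P}_d(K)=\{z\in\mathbb{C}:\ |P(z)|\le\|P\|_K\text{ for all polynomials }P\text{ with }\deg P\le d\}$. A real half-line from the origin is a set $\{t u:\ t\ge 0\}$ with $u\in\mathbb{C}$, $|u|=1$. *)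

(* Defs.v *)
(* The complex numbers are modelled by R[i] for R : realType. *)
From mathcomp Require Import all_boot all_order all_algebra.
From mathcomp Require Import complex.
From mathcomp Require Import boolp classical_sets reals.

Set Implicit Arguments.
Unset Strict Implicit.
Unset Printing Implicit Defensive.

Import Order.TTheory GRing.Theory Num.Theory.

Local Open Scope classical_set_scope.
Local Open Scope ring_scope.
Local Open Scope complex_scope.

(* Normc.normc is the R-valued modulus (the generic norm `|z| is
   R[i]-valued).  The real supremum is the mathematical one as soon as K is
   nonempty and the polynomial is bounded on K, e.g. for nonempty compact K. *)
Definition poly_supnorm (R : realType) (K : set R[i]) (p : {poly R[i]}) : R :=
  sup [set Normc.normc p.[z] | z in K].

(* size p <= d.+1 means deg p <= d, the zero polynomial being included. *)
Definition poly_hull (R : realType) (d : nat) (K : set R[i]) : set R[i] :=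
  [set w | forall p : {poly R[i]}, (size p <= d.+1)%N ->
     Normc.normc p.[w] <= poly_supnorm K p].

Definition is_half_line (R : realType) (L : set R[i]) : Prop :=
  exists2 u : R[i], Normc.normc u = 1 &
    L = [set t%:C * u | t in [set t : R | 0 <= t]].

(* Main.v *)
(* By Lagrange interpolation at the n+1 points, evaluation at w on polynomials
   of degree at most n is p |-> sum_i p(z_i) l_i(w), and the values p(z_i) are
   arbitrary; hence w lies in the hull iff sum_i |l_i(w)| <= 1.  Since
   sum_i l_i(w) = 1, this is the equality case of the triangle inequality,
   i.e. all l_i(w) have the same argument.  Finally, l_i(w) times
   (z_i - w) prod_(j != i) (z_i - z_j) does not depend on i. *)
Require Import Defs.
From mathcomp Require Import all_boot all_order all_algebra.
From mathcomp Require Import complex.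
From mathcomp Require Import boolp classical_sets reals.
From mathcomp Require Import ring.

Set Implicit Arguments.
Unset Strict Implicit.
Unset Printing Implicit Defensive.

Import Order.TTheory GRing.Theory Num.Theory.

Local Open Scope classical_set_scope.
Local Open Scope ring_scope.

Section LagrangeInterpolation.
Variables (F : fieldType) (n : nat) (z : 'I_n.+1 -> F).
Hypothesis z_inj : injective z.

(* MathComp's [lagrange] requires an injective family indexed by all of nat. *)
Definition lagrange_poly (i : 'I_n.+1) : {poly F} :=
  (\prod_(j < n.+1 | j != i) (z i - z j))^-1 *:
    \prod_(j < n.+1 | j != i) ('X - (z j)%:P).

Lemma prod_node_sub_neq0 i : \prod_(j < n.+1 | j != i) (z i - z j) != 0.
Proof.
by apply/prodf_neq0 => j ji; rewrite subr_eq0 inj_eq // eq_sym.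
Qed.

Lemma size_lagrange_poly i : (size (lagrange_poly i) <= n.+1)%N.
Proof.
apply: leq_trans (size_scale_leq _ _) _.
rewrite -big_filter -(big_map z predT (fun x => 'X - x%:P)) size_prod_XsubC.
by rewrite size_map size_filter -sum1_count sum1_card cardC1 card_ord.
Qed.

Lemma horner_lagrange_poly i x :
  (lagrange_poly i).[x] =
  (\prod_(j < n.+1 | j != i) (z i - z j))^-1 *
    \prod_(j < n.+1 | j != i) (x - z j).
Proof.
rewrite hornerZ horner_prod; congr (_ * _).
by apply: eq_bigr => j _; rewrite hornerXsubC.
Qed.

Lemma lagrange_poly_node i j : (lagrange_poly i).[z j] = (i == j)%:R.
Proof.
rewrite horner_lagrange_poly; have [->|ij] := eqVneq i j.
  by rewrite mulVf ?prod_node_sub_neq0.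
by rewrite [X in _ * X](bigD1 j) 1?eq_sym //= subrr mul0r mulr0.
Qed.

Lemma horner_lagrange_comb (c : 'I_n.+1 -> F) j :
  (\sum_i c i *: lagrange_poly i).[z j] = c j.
Proof.
rewrite horner_sum (bigD1 j) //= big1 ?addr0 => [|i /negPf ij].
  by rewrite hornerZ lagrange_poly_node eqxx mulr1.
by rewrite hornerZ lagrange_poly_node ij mulr0.
Qed.

Lemma size_lagrange_comb (c : 'I_n.+1 -> F) :
  (size (\sum_i c i *: lagrange_poly i)%R <= n.+1)%N.
Proof.
apply: leq_trans (size_sum _ _ _) _; apply/bigmax_leqP => i _.
exact: leq_trans (size_scale_leq _ _) (size_lagrange_poly i).
Qed.

(** The difference of the two sides has degree at most [n] and vanishes at the [n.+1] distinct
    nodes, so it is zero. *)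
Lemma lagrange_interpolation (p : {poly F}) :
  (size p <= n.+1)%N -> p = \sum_i p.[z i] *: lagrange_poly i.
Proof.
move=> sp; apply/eqP; rewrite -subr_eq0; apply/negPn/negP => d_neq0.
have : (size (codom z) < n.+1)%N.
  apply: leq_trans (max_poly_roots d_neq0 _ _) _; last 1 first.
  - by rewrite (leq_trans (size_polyD _ _)) // geq_max sp size_polyN
      size_lagrange_comb.
  - apply/allP => _ /codomP[j ->].
    by rewrite rootE hornerD hornerN horner_lagrange_comb subrr.
  - by rewrite map_inj_uniq ?enum_uniq.
by rewrite size_codom card_ord ltnn.
Qed.

(** Interpolation of the constant polynomial 1. *)
Lemma sum_lagrange_poly x : \sum_i (lagrange_poly i).[x] = 1.
Proof.
have /(congr1 (horner^~ x)) : 1 = \sum_i 1.[z i] *: lagrange_poly i.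
  by apply: lagrange_interpolation; rewrite size_poly1.
rewrite horner_sum hornerC => ->.
by apply: eq_bigr => i _; rewrite hornerZ hornerC mul1r.
Qed.

Lemma lagrange_poly_mul i x :
  (lagrange_poly i).[x] *
    ((z i - x) * \prod_(j < n.+1 | j != i) (z i - z j)) =
  - \prod_j (x - z j).
Proof.
rewrite horner_lagrange_poly [in RHS](bigD1 i) //=.
by field; apply: prod_node_sub_neq0.
Qed.

End LagrangeInterpolation.

Section Hull.
Variables (R : realType) (n : nat) (z : 'I_n.+1 -> R[i]).

(** Together with [lecR], this moves inequalities between the real modulus of the definitions and
    the [R[i]]-valued norm. *)
Lemma normC_normc (x : R[i]) : `|x| = (Normc.normc x)%:C%C.
Proof. by case: x. Qed.

Lemma le_poly_supnorm_range (p : {poly R[i]}) i :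
  Normc.normc p.[z i] <= poly_supnorm (range z) p.
Proof.
apply: ub_le_sup; last by exists (z i) => //; exists i.
(* The sum of the finitely many moduli bounds each of them, so [sup] is a genuine supremum. *)
exists (\sum_j Normc.normc p.[z j]) => _ [_ [j _ <-] <-].
rewrite -lecR raddf_sum /= (bigD1 j) //= -!normC_normc lerDl.
by apply: sumr_ge0 => k _; rewrite -normC_normc.
Qed.

Lemma poly_supnorm_range_le (p : {poly R[i]}) (M : R) :
  (forall i, Normc.normc p.[z i] <= M) -> poly_supnorm (range z) p <= M.
Proof.
move=> pM; apply: ge_sup => [|_ [_ [j _ <-] <-]]; last exact: pM.
by exists (Normc.normc p.[z ord0]); exists (z ord0) => //; exists ord0.
Qed.

Hypothesis z_inj : injective z.

Lemma poly_hull_lagrange (w : R[i]) :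
  poly_hull n (range z) w <->
  \sum_i `|(lagrange_poly z i).[w]| <= 1.
Proof.
set l := fun i => (lagrange_poly z i).[w].
split=> [hull_w|l_le1 p sp].
  (* Conjugate phase of [l i], chosen so that [c i * l i] is the modulus of [l i]; if [l i = 0],
     division by zero gives [c i = 0]. *)
  pose c i := (l i)^* / `|l i|.
  have c_le1 i : `|c i| <= 1.
    rewrite normrM norm_conjC normfV normr_id.
    have [->|l0] := eqVneq (l i) 0; first by rewrite normr0 mul0r ler01.
    by rewrite mulfV ?normr_eq0.
  pose p := \sum_i c i *: lagrange_poly z i.
  have pw : p.[w] = \sum_i `|l i|.
    rewrite horner_sum; apply: eq_bigr => i _; rewrite hornerZ -/(l i) /c.
    have [->|l0] := eqVneq (l i) 0; first by rewrite mulr0 normr0.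
    by rewrite mulrAC -[_^* * _]mulrC -normCK expr2 mulfK ?normr_eq0.
  have : Normc.normc p.[w] <= 1.
    apply: le_trans (hull_w p (size_lagrange_comb _ _)) _.
    apply: poly_supnorm_range_le => i.
    by rewrite horner_lagrange_comb // -lecR -normC_normc.
  rewrite -lecR -normC_normc pw ger0_norm //.
  exact: sumr_ge0.
rewrite -lecR -normC_normc (lagrange_interpolation z_inj sp) horner_sum.
set M := (X in _ <= X).
(* The interpolation formula also replaced [p] inside the supremum norm; it is folded back there. *)
rewrite -(lagrange_interpolation z_inj sp) in M *.
have M_ge i : `|p.[z i]| <= M by rewrite normC_normc lecR le_poly_supnorm_range.
apply: le_trans (ler_norm_sum _ _ _) _.
apply: (@le_trans _ _ (\sum_i M * `|l i|)).
  by apply: ler_sum => i _; rewrite hornerZ normrM ler_wpM2r.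
by rewrite -mulr_sumr ler_piMr // (le_trans _ (M_ge ord0)).
Qed.

End Hull.

Theorem lemma8 (R : realType) (n : nat) (n_ge1 : (1 <= n)%N)
    (z : 'I_n.+1 -> R[i]) (z_inj : injective z)
    (K : set R[i]) (KE : K = range z)
    (w : R[i]) (wNK : ~ K w) :
  poly_hull n K w <->
  exists2 L : set R[i], is_half_line L &
    forall i : 'I_n.+1,
      L ((z i - w) * \prod_(j < n.+1 | j != i) (z i - z j)).
Proof.
rewrite {}KE in wNK *; rewrite (poly_hull_lagrange z_inj).
set a := fun i => (z i - w) * \prod_(j < n.+1 | j != i) (z i - z j).
set l := fun i => (lagrange_poly z i).[w].
pose W := - \prod_j (w - z j).
have laW i : l i * a i = W by exact: lagrange_poly_mul.
have W_neq0 : W != 0.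
  (* A vanishing factor would put [w] in [K]. *)
  rewrite oppr_eq0; apply/prodf_neq0 => j _; rewrite subr_eq0.
  by apply/eqP => wzj; apply: wNK; exists j.
have l_neq0 i : l i != 0.
  by apply: contra_neq W_neq0 => l0; rewrite -(laW i) l0 mul0r.
have sum_l : \sum_i l i = 1 by exact: sum_lagrange_poly.
split=> [l_le1 | [L [u u1 ->] aL]].
  (* Equality case of the triangle inequality: all [l i] share one unit phase [t]. *)
  have [|t /eqP t1 lt] := @normC_sum_eq _ _ predT l.
    apply/le_anti; rewrite ler_norm_sum /=.
    by rewrite [\sum_i l i]sum_l normr1.
  have t_neq0 : t != 0 by rewrite -normr_eq0 t1 oner_eq0.
  (* Since [a i = W / l i], the phase of every [a i] is that of [W] divided by [t]. *)
  pose u := W / (`|W| * t).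
  exists [set s%:C%C * u | s in [set s : R | 0 <= s]].
    exists u => //; apply: (@complexI R); rewrite -normC_normc.
    by rewrite normrM normfV normrM normr_id t1 mulr1 mulfV ?normr_eq0.
  move=> i; exists (Normc.normc W / Normc.normc (l i)).
    by rewrite /= -lecR rmorphM fmorphV /= -!normC_normc divr_ge0.
  rewrite rmorphM fmorphV /= -!normC_normc -/(a i).
  apply: (mulfI (l_neq0 i)); rewrite laW {1}(lt i) // /u.
  have nW_neq0 : `|W| != 0 by rewrite normr_eq0.
  have nl_neq0 : `|l i| != 0 by rewrite normr_eq0.
  by field; apply/and3P.
have {}aL i : a i = `|a i| * u.
  have [s s_ge0 aE] := aL i; rewrite -[a i]aE normrM (normC_normc u) u1 mulr1.
  by rewrite ger0_norm // lecR.
suff <- : `|\sum_i l i| = \sum_i `|l i| by rewrite sum_l normr1.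
have u_norm1 : `|u| = 1 by rewrite normC_normc u1.
have u_neq0 : u != 0 by rewrite -normr_eq0 u_norm1 oner_eq0.
(* Conversely [l i = W / a i], so every [l i] has the phase of [W] divided by [u], and the moduli
   add up. *)
have lE i : l i = `|l i| * (W / (`|W| * u)).
  have a_neq0 : a i != 0.
    by apply: contra_neq W_neq0 => a0; rewrite -(laW i) a0 mulr0.
  apply: (mulIf a_neq0); rewrite laW [in RHS]aL -(laW i) normrM.
  have na_neq0 : `|a i| != 0 by rewrite normr_eq0.
  have nl_neq0 : `|l i| != 0 by rewrite normr_eq0.
  by field; apply/and3P.
rewrite (eq_bigr _ (fun i _ => lE i)) -mulr_suml normrM normrM normfV.
rewrite normrM normr_id u_norm1 mulr1 mulfV ?normr_eq0 // mulr1 ger0_norm //.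
exact: sumr_ge0.
Qed.
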